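(* Let $n$ and $d$ be positive integers. Any polynomial $h$ of degree $n$ in $n+d$ variables satisfies the identity $$\sum_{P} w(P)\; DS_{\mathcal C_{n+d}}\left(\prod_{p\in P}(x_{p+1}-x_{p})\cdot h(z_1^P,\dots,z_{n+d}^P)\right)=(n+d)!\,h(1,1,\dots,1),$$ where the sum is over all $d$-element subsets $P$ of the vertex set $\{1,\dots,n+d\}$ of the cycle $\mathcal C_{n+d}$.
   Context: $\mathcal C_{n+d}$ is the cycle with $n+d$ vertices $1,\dots,n+d$ counted counter-clockwise, and $x_1,\dots,x_{n+d}$ are the corresponding variables. Indices are taken modulo $n+d$. Divided symmetrization: the variables are ordered by $x_1<x_2<\dots<x_m$, and for a graph $G$ with vertex set $\{x_1,\dots,x_m\}$ and edge set $E$, whose edges are written as pairs $(x,y)$ with $x<y$, and for a polynomial $f$ in $x_1,\dots,x_m$ (with coefficients in some field), $$DS_G(f)=\operatorname{Sym}\left(\frac{f}{\prod_{(x,y)\in E}(x-y)}\right),$$ where for a rational function $\varphi$, $\operatorname{Sym}\varphi=\sum_\pi\varphi(\pi_1,\dots,\pi_m)$ is the sum over all $m!$ permutations $\pi$ of the variables. Thus for $G=\mathcal C_{n+d}$ (with $m=n+d$) the denominator is $(x_1-x_{n+d})\prod_{i=1}^{n+d-1}(x_i-x_{i+1})$. Let $P$ be a $d$-element subset of $\{1,\dots,n+d\}$. The weight $w(P)$ is the product of the sizes of the $d$ groups into which the vertices of $P$ divide the cycle, each vertex of $P$ belonging to exactly one group (so the sizes sum to $n+d$). Explicitly, $w(P)=\prod_{p\in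 P}g(p)$, where $g(p)$ is the smallest positive integer $k$ with $p+k\in P$ (modulo $n+d$). For $i\notin P$, $z_i=z_i^P$ is the sum of the variables between $i$ and the clockwise-next to $i$ vertex $p(i)$ of $P$, with $i$ included and $p(i)$ not included; explicitly, if $k$ is the smallest positive integer with $i-k\in P$ (modulo $n+d$), then $z_i^P=x_i+x_{i-1}+\dots+x_{i-k+1}$. For $i\in P$, $z_i^P=1$.
   Formalization: The polynomial h is taken homogeneous of degree n (h = x_1+1 with n=d=1 gives 2 ≠ 4), and the right-hand side carries the factor (-1)^(d+1), since with the stated orientation the printed sign fails for even d (n=1, d=2, h=x_3 gives -6 ≠ 6). *)

(* Defs.v *)
(* Built on Mathematical Components with multinomials. *)
From HB Require Import structures.
From mathcomp Require Import all_boot all_algebra all_fingroup.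
From mathcomp Require Import generic_quotient fraction.
From mathcomp Require Export mpoly.

Set Implicit Arguments.
Unset Strict Implicit.
Unset Printing Implicit Defensive.

Import GRing.Theory.
Local Open Scope ring_scope.
Local Open Scope quotient_scope.

Notation "x %:F" := (@FracField.tofrac _ x).

Section DividedSymmetrization.

Variables (m : nat) (F : fieldType).
Implicit Types (phi : {fraction {mpoly F[m]}}) (s : 'S_m) (f g : {mpoly F[m]}).

(* phi(x_(s 1), ..., x_(s m)): msym s sends 'X_i to 'X_(s i).  The value does
   not depend on the chosen representative of phi, see fracsymE. *)
Definition fracsym s phi : {fraction {mpoly F[m]}} :=
  (msym s \n_(repr phi))%:F / (msym s \d_(repr phi))%:F.

Lemma fracsymE s f g :
  g != 0 -> fracsym s (f%:F / g%:F) = (msym s f)%:F / (msym s g)%:F.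
Proof.
have numdenE phi : phi = (\n_(repr phi))%:F / (\d_(repr phi))%:F.
  have d0 : \d_(repr phi) != 0 := denom_ratioP _.
  apply: (canRL (mulfK _)); first by rewrite tofrac_eq0.
  elim/quotW: phi d0 => r d0; unlock FracField.tofrac.
  rewrite -[LHS]/(FracField.mul _ _) !piE; apply/eqmodP.
  rewrite /= FracField.equivfE /FracField.mulf !numden_Ratio ?mulr1 ?oner_neq0 ?denom_ratioP //.
  by rewrite FracField.equivf_r mulrC.
have msym0 (p : {mpoly F[m]}) : p != 0 -> (msym s p)%:F != 0.
  move=> p0; rewrite tofrac_eq0; apply: contraNneq p0 => sp0.
  by apply/eqP; apply: (@inj_msym _ _ s); rewrite raddf0.
move=> g0; rewrite /fracsym.
have := numdenE (f%:F / g%:F); set r := repr _ => phiE.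
have d0 : \d_r != 0 := denom_ratioP _.
apply/eqP; rewrite eqr_div ?msym0 // -!tofracM tofrac_eq -!msymM.
have /eqP := phiE; rewrite eqr_div ?tofrac_eq0 // -!tofracM tofrac_eq.
by move/eqP->.
Qed.

Definition Sym phi : {fraction {mpoly F[m]}} := \sum_(s : 'S_m) fracsym s phi.

(* Edges are listed with multiplicity, each as a pair (i, j) with i < j. *)
Definition DS (E : seq ('I_m * 'I_m)) f : {fraction {mpoly F[m]}} :=
  Sym (f%:F / (\prod_(e <- E) ('X_(e.1) - 'X_(e.2)))%:F).

End DividedSymmetrization.

Section Cycle.

Variable m : nat.
Implicit Types (i : 'I_m) (P : {set 'I_m}).

(* The vertices 1, ..., m are numbered from 0, and ordS / ord_pred are the
   cyclic successor (counter-clockwise) and predecessor.  The closing edge is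
   (0, m.-1), so for m > 1 the denominator
   (x_1 - x_m) * \prod_(1 <= i < m) (x_i - x_(i+1)) is minus the cyclic product
   of the x_i - x_(i+1).  When m = 2 the edge (0, 1) occurs twice. *)
Definition cycle_edges : seq ('I_m * 'I_m) :=
  [seq if (i < ordS i)%N then (i, ordS i) else (ordS i, i) | i <- enum 'I_m].

(* The least k > 0 such that the k-th iterate of s at i is in P. *)
Definition hit (s : 'I_m -> 'I_m) P i : nat :=
  (find (mem P) (traject s (s i) m)).+1.

Definition gap P i : nat := hit (@ordS m) P i.

Definition weight P : nat := (\prod_(p in P) gap P p)%N.

Definition zvar (F : fieldType) P i : {mpoly F[m]} :=
  if i \in P then 1
  else \sum_(j < hit (@ord_pred m) P i) 'X_(iter j (@ord_pred m) i).

Lemma val_iter_ordS i k : val (iter k (@ordS m) i) = ((i + k) %% m)%N.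
Proof.
elim: k => [|k IHk] /=; first by rewrite addn0 modn_small.
by rewrite IHk -addn1 modnDml addn1 addnS.
Qed.

Lemma iter_ordS_m i : iter m (@ordS m) i = i.
Proof. by apply: val_inj; rewrite val_iter_ordS modnDr modn_small. Qed.

Lemma hitP (s : 'I_m -> 'I_m) P i :
  (exists2 k, (k < m)%N & iter k.+1 s i \in P) ->
  [/\ iter (hit s P i) s i \in P, (hit s P i <= m)%N
    & forall k, (0 < k < hit s P i)%N -> iter k s i \notin P].
Proof.
case=> k0 lt_k0 Pk0; set t := traject s (s i) m.
have tE k : (k < m)%N -> nth i t k = iter k.+1 s i.
  by move=> ltk; rewrite (set_nth_default (s i)) ?size_traject // nth_traject // -iterSr.
have hasP : has (mem P) t.
  by apply/(has_nthP i); exists k0; rewrite ?size_traject ?tE.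
have lt_hit : (find (mem P) t < m)%N by move: hasP; rewrite has_find size_traject.
split=> [||[|k] //= /[!ltnS] ltk]; rewrite /hit //.
  by rewrite -tE //; apply: (nth_find i hasP).
by rewrite -iterS -tE ?(ltn_trans ltk) //; apply/negbT/(before_find i ltk).
Qed.

Lemma gapP P p : p \in P ->
  [/\ iter (gap P p) (@ordS m) p \in P, (gap P p <= m)%N
    & forall k, (0 < k < gap P p)%N -> iter k (@ordS m) p \notin P].
Proof.
move=> pP; apply: hitP.
have m_gt0 : (0 < m)%N by apply: leq_ltn_trans (ltn_ord p).
by exists m.-1; rewrite prednK // iter_ordS_m.
Qed.

Lemma hit_predP P i q : q \in P ->
  [/\ iter (hit (@ord_pred m) P i) (@ord_pred m) i \in P,
      (hit (@ord_pred m) P i <= m)%N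
    & forall k, (0 < k < hit (@ord_pred m) P i)%N ->
        iter k (@ord_pred m) i \notin P].
Proof.
move=> qP; apply: hitP.
have m_gt0 : (0 < m)%N by apply: leq_ltn_trans (ltn_ord q).
have iter_predS k : cancel (iter k (@ordS m)) (iter k (@ord_pred m)).
  by elim: k => [|k IHk] j //=; rewrite -iterS iterSr ordSK IHk.
exists ((i + m - q.+1) %% m)%N; first by rewrite ltn_mod.
set k := (_ %% m)%N; suff <- : iter k.+1 (@ordS m) q = i by rewrite iter_predS.
apply: val_inj; rewrite val_iter_ordS addnS -addSn modnDmr subnKC.
  by rewrite modnDr modn_small.
by rewrite (leq_trans (ltn_ord q)) ?leq_addl.
Qed.

End Cycle.

(* Main.v *)
Require Import Defs.
From HB Require Import structures.
From mathcomp Require Import all_boot all_algebra all_fingroup.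
From mathcomp Require Import generic_quotient fraction mpoly.
From mathcomp Require Import zify ring.

Set Implicit Arguments.
Unset Strict Implicit.
Unset Printing Implicit Defensive.

Import GRing.Theory.
Local Open Scope ring_scope.

(* By linearity h is a monomial x^c with |c| = n.  The factors x_(p+1) - x_p
   cut the cycle into d paths (blocks), whose symmetrized sums vanish as soon as
   the numerator has too small a degree in one of the blocks.  Since
   2 z_i - z_(i-1) - z_(i+1) = x_i - x_(i+1) up to terms that are negligible in
   this sense or symmetric in a block, and since x_i - x_(i+1) cuts the block of
   i in two, the sum L(c) over P is harmonic in c:
     2 L(c + e_i) = L(c + e_(i-1)) + L(c + e_(i+1))   whenever c_i > 0.
   Hence i |-> L(c + e_i) is affine along the runs of the support of c, and
   L is constant as soon as it is constant on the 0/1 vectors c; for these only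
   P = {i | c_i = 0} contributes, and the blocks contribute independently.
   All this divides by integers, so it is done in the field of fractions of
   Z[x_1, ..., x_m], and then transferred to any field after clearing
   denominators. *)

(** * Degrees of products, and sums of distinct exponents *)

Lemma msize_prod_le (R : idomainType) k (I : Type) (r : seq I) (P : pred I)
    (p : I -> {mpoly R[k]}) (d : I -> nat) :
  (forall i, P i -> (msize (p i) <= (d i).+1)%N) ->
  (msize (\prod_(i <- r | P i) p i) <= (\sum_(i <- r | P i) d i).+1)%N.
Proof.
move=> dP; apply: (big_ind2 (fun q e => msize q <= e.+1)%N) => // [|p1 d1 p2 d2 le1 le2].
  by rewrite msize1.
have [->|p1n0] := eqVneq p1 0; first by rewrite mul0r msize0.
have [->|p2n0] := eqVneq p2 0; first by rewrite mulr0 msize0.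
by rewrite msizeM //; lia.
Qed.

(** Among [k.+1] distinct naturals one is at least [k]; removing it leaves [k] distinct ones. *)
Lemma sum_inj_ge k (f : 'I_k -> nat) :
  injective f -> ('C(k, 2) <= \sum_(i < k) f i)%N.
Proof.
elim: k f => [|k IHk] f f_inj; first by rewrite big_ord0.
have [i le_k_fi] : exists i, (k <= f i)%N.
  apply/existsP; apply: contraT; rewrite negb_exists => /forallP ltf.
  have ltfk i : (f i < k)%N by rewrite ltnNge ltf.
  have /leq_card : injective (fun i => Ordinal (ltfk i)).
    by move=> i j /(congr1 val) /f_inj.
  by rewrite !card_ord ltnn.
rewrite (bigD1_ord i) //= binS bin1 addnC leq_add //.
by apply: IHk => j l /f_inj /lift_inj.
Qed.

(** * Symmetrization along a path *)

Section Path.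

Variable k : nat.

Definition path_den (R : comNzRingType) (y : 'I_k -> R) : R :=
  \prod_(l < k | (l.+1 < k)%N) (y l - y (ordS l)).

(** Peels the adjacent pairs off a product over pairs i < j; in the Vandermonde product they form
    [path_den] up to sign. *)
Lemma big_gt_ordS (R : Type) (idx : R) (op : Monoid.com_law idx)
    (i : 'I_k) (G : 'I_k -> R) :
  \big[op/idx]_(j < k | (i < j)%N) G j =
  op (if (i.+1 < k)%N then G (ordS i) else idx) (\big[op/idx]_(j < k | (i.+1 < j)%N) G j).
Proof.
case: ifP => lt_ik.
  have oSi : ordS i = i.+1 :> nat by rewrite /= modn_small.
  rewrite (bigD1 (ordS i)) ?oSi //=; congr (op _ _); apply: eq_bigl => j.
  by rewrite -val_eqE [val (ordS i)]oSi andbC eq_sym -ltn_neqAle.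
rewrite Monoid.mul1m; apply: eq_bigl => j.
by have := ltn_ord j; move: lt_ik; lia.
Qed.

(* Multiplying by the Vandermonde product turns the sum into an antisymmetrized
   polynomial, all of whose monomials have two equal exponents. *)
Lemma path_vanish (K : fieldType) (y : 'I_k -> K) (q : {mpoly K[k]}) :
  injective y -> (msize q < k)%N ->
  \sum_(t : 'S_k) q.@[fun l => y (t l)] / path_den (fun l => y (t l)) = 0.
Proof.
move=> y_inj lt_qk.
(* [V] is the Vandermonde product, [G] its non-adjacent factors, and [eps] the sign from reversing
   the adjacent ones. *)
pose V z := \prod_(i < k) \prod_(j < k | (i < j)%N) (z j - z i) : K.
pose eps : K := \prod_(l < k | (l.+1 < k)%N) -1.
pose G : {mpoly K[k]} := \prod_(i < k) \prod_(j < k | (i.+1 < j)%N) ('X_j - 'X_i).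
have VE z : V z = eps * G.@[z] * path_den z.
  rewrite /V (eq_bigr _ (fun i _ => big_gt_ordS _ i _)) big_split /= mulrAC.
  congr (_ * _); last first.
    rewrite rmorph_prod; apply: eq_bigr => i _; rewrite rmorph_prod /=.
    by apply: eq_bigr => j _; rewrite mevalB !mevalXU.
  rewrite -big_mkcond -big_split /=; apply: eq_bigr => i _.
  by rewrite mulN1r opprB.
have V_alt (t : 'S_k) : V (fun l => y (t l)) = (-1) ^+ t * V y.
  have VdetE z : V z = \det (Vandermonde k (\row_i z i)).
    by rewrite det_Vandermonde; do 2!apply: eq_bigr => ? _; rewrite !mxE.
  rewrite !VdetE -odd_permV -det_perm mulrC -det_mulmx -col_permE.
  by congr (\det _); apply/matrixP => i j; rewrite !mxE.
have Vy0 : V y != 0.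
  apply/prodf_neq0 => i _; apply/prodf_neq0 => j lt_ij.
  by rewrite subr_eq0 inj_eq // neq_ltn lt_ij orbT.
transitivity (eps / V y * \sum_(t : 'S_k) (-1) ^+ t * (q * G).@[fun l => y (t l)]).
  rewrite mulr_sumr; apply: eq_bigr => t _.
  have := V_alt t; rewrite VE mevalM => Vt.
  have : (-1) ^+ t * V y != 0 by rewrite mulf_neq0 ?signr_eq0.
  rewrite -Vt !mulf_eq0 !negb_or => /andP[/andP[e0 G0] d0].
  have -> : V y = (-1) ^+ t * (eps * G.@[fun l => y (t l)] * path_den (fun l => y (t l))).
    by rewrite Vt signrMK.
  move: (q.@[_]) (G.@[_]) (path_den _) (eps) G0 d0 e0 => a b c e b0 c0 e0.
  by case: (odd_perm t); rewrite /= ?expr0 ?expr1; field;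
    rewrite ?(e0, b0, c0, oppr_eq0, oner_neq0).
suff -> : \sum_(t : 'S_k) (-1) ^+ t * (q * G).@[fun l => y (t l)] = 0 by rewrite mulr0.
under eq_bigr do rewrite mevalE mulr_sumr.
rewrite exchange_big /= big_seq big1 // => c c_supp.
under eq_bigr do rewrite mulrCA.
rewrite -mulr_sumr.
(* By the Leibniz formula each monomial yields a determinant, with equal rows when [c] takes equal
   values. *)
have -> : \sum_(t : 'S_k) (-1) ^+ t * \prod_i y (t i) ^+ c i
    = \det (\matrix_(i, j) (y j ^+ c i)).
  by apply: eq_bigr => t _; congr (_ * _); apply: eq_bigr => i _; rewrite mxE.
suff [i [j [ne_ij eq_c]]] : exists i j, i != j /\ c i = c j.
  by rewrite (determinant_alternate ne_ij) ?mulr0 // => l; rewrite !mxE eq_c.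
suff : ~~ injectiveb c.
  case/injectivePn => i [j ne_ij eq_c]; by exists i, j.
(* Distinct exponents force degree at least 'C(k, 2), whereas a nonzero [q * G] has degree at most
   (k - 2) + 'C(k.-1, 2), which is one less. *)
apply/injectiveP => /sum_inj_ge; rewrite -mdegE leqNgt => /negP[].
have {c_supp} := msize_mdeg_lt c_supp.
have [->|q0] := eqVneq q 0; first by rewrite mul0r msize0.
have [->|G0] := eqVneq G 0; first by rewrite mulr0 msize0.
have leG : (msize G <= 'C(k.-1, 2).+1)%N.
  have -> : 'C(k.-1, 2) = (\sum_(i < k) \sum_(j < k | (i.+1 < j)%N) 1)%N.
    under eq_bigr => i _.
      rewrite -(big_mkord (fun j => i.+1 < j)%N (fun=> 1%N)).
      rewrite -(big_nat_widenl i.+2 0 k predT) // sum_nat_const_nat muln1; over.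
    elim: (k) => [|k' IHk']; first by rewrite big_ord0.
    rewrite big_ord_recl /= (eq_bigr (fun i : 'I_k' => k' - i.+2)%N) // -IHk'.
    by case: k' {IHk'} => // k'; rewrite binS bin1 /= addnC subSS subn1.
  apply: msize_prod_le => i _; apply: msize_prod_le => j _.
  rewrite (leq_trans (msizeD_le _ _)) // geq_max msizeN !msizeX !mdeg1.
  by [].
rewrite msizeM //.
move: (msize q) (msize G) (mdeg c) lt_qk leG => a b e.
case: (k) => // -[|k'] /=; rewrite ?binS ?bin0 ?bin1 /=; lia.
Qed.

End Path.

(** * The value of the path sum for the product of partial sums *)

Section PathSum.

Variable K : fieldType.

(** For values along a block, this is the product of the z's at all vertices but the last. *)
Definition path_num (R : comNzRingType) k (y : 'I_k -> R) : R :=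
  \prod_(l < k | (l.+1 < k)%N) \sum_(j < k | (j <= l)%N) y j.

(* The summand path_num / path_den as a function of the list of values, with
   [z] added to all the partial sums. *)
Fixpoint wpath (z : K) (s : seq K) : K :=
  if s is u :: r then
    if r is v :: _ then (z + u) / (u - v) * wpath (z + u) r else 1
  else 1.

Lemma wpath_cons z u v r :
  wpath z [:: u, v & r] = (z + u) / (u - v) * wpath (z + u) (v :: r).
Proof. by []. Qed.

Arguments wpath : simpl never.

Definition insert j (c : K) s := take j s ++ c :: drop j s.

(** Induction that strips the first value into the accumulator [z]. Insertions at positions 0 and 1
    are explicit; the later ones are given by the induction hypothesis less its own insertion at
    position 0. *)
Lemma sum_wpath_insert0 z u w :
  0 \notin u :: w -> uniq (u :: w) ->
  \sum_(j < (size w).+2) wpath z (insert j 0 (u :: w))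
  = (size w).+1%:R * wpath z (u :: w).
Proof.
elim: w z u => [|v w IHw] z u.
  rewrite mem_seq1 eq_sym => u0 _; rewrite big_ord_recl big_ord1 /insert /= !wpath_cons.
  by field; rewrite u0 oppr_eq0 u0.
rewrite inE negb_or eq_sym => /andP[u0 vw0] /= /andP[]; rewrite inE negb_or => /andP[ne_uv _] uvw.
have v0 : v != 0 by move: vw0; rewrite inE negb_or eq_sym => /andP[].
have := IHw (z + u) v vw0 uvw.
rewrite big_ord_recl; set S := \sum_(i < _) _; set B := wpath (z + u) (v :: w).
rewrite {1}/insert /= wpath_cons addr0 -/B => /(canRL (addKr _)) SE.
rewrite 2!big_ord_recl.
have -> : \sum_(i < (size w).+1) wpath z (insert (lift ord0 (lift ord0 i)) 0 [:: u, v & w])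
    = (z + u) / (u - v) * S.
  by rewrite mulr_sumr; apply: eq_bigr => i _; rewrite /insert /= wpath_cons.
rewrite {}SE /insert /= !wpath_cons !addr0 -/B.
have uv0 : u - v != 0 by rewrite subr_eq0.
rewrite [(size w).+2%:R]mulrSr.
by field; rewrite !oppr_eq0 u0 v0 uv0.
Qed.

Lemma wpathE z s :
  wpath z s = \prod_(l < (size s).-1)
    ((z + \sum_(j < l.+1) s`_j) / (s`_l - s`_l.+1)).
Proof.
elim: s z => [|u [|v r] IHs] z; rewrite ?big_ord0 //.
rewrite wpath_cons IHs /= big_ord_recl big_ord1 /=.
congr (_ * _); apply: eq_bigr => l _; rewrite [in RHS]big_ord_recl /= addrA.
by [].
Qed.

Lemma wpath_enum k (y : 'I_k.+1 -> K) :
  path_num y / path_den y = wpath 0 [seq y i | i <- enum 'I_k.+1].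
Proof.
have nthE (i : 'I_k.+1) : [seq y i | i <- enum 'I_k.+1]`_i = y i.
  by rewrite (nth_map ord0) ?size_enum_ord // nth_ord_enum.
rewrite wpathE size_map size_enum_ord /= /path_num /path_den -prodf_div.
rewrite (big_ord_narrow (leqnSn k)); apply: eq_bigr => l _.
rewrite add0r; congr (_ / (_ - _)).
- have lel : (l.+1 <= k.+1)%N by rewrite ltnS ltnW.
  rewrite [LHS](big_ord_narrow lel); apply: eq_bigr => j _.
  by rewrite -nthE.
- by rewrite -nthE.
- by rewrite -nthE /= modn_small ?ltnS.
Qed.

(** [lift_perm j ord0 t] sends [j] to [ord0] and acts as [t], relabelled, on the other positions. *)
Lemma perm_insert k (y : 'I_k.+2 -> K) (j : 'I_k.+2) (t : 'S_k.+1) :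
  [seq y (lift_perm j ord0 t i) | i <- enum 'I_k.+2] =
  insert j (y ord0) [seq y (lift ord0 (t i)) | i <- enum 'I_k.+1].
Proof.
have sz : size [seq y (lift ord0 (t i)) | i <- enum 'I_k.+1] = k.+1.
  by rewrite size_map size_enum_ord.
have szt : size (take j [seq y (lift ord0 (t i)) | i <- enum 'I_k.+1]) = j.
  by rewrite size_takel // sz -ltnS.
apply: (@eq_from_nth _ 0) => [|i].
  by rewrite size_map size_enum_ord size_cat szt /= size_drop sz; have := ltn_ord j; lia.
rewrite size_map size_enum_ord => lti.
rewrite (nth_map ord0) ?size_enum_ord // -[i]/(nat_of_ord (Ordinal lti)) nth_ord_enum.
rewrite nth_cat szt; move: (Ordinal lti) => {lti}i.
case: (unliftP j i) => [i'|] ->; last by rewrite ltnn subnn lift_perm_id.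
rewrite lift_perm_lift /= /bump.
case: (leqP j i') => le_ji'.
  rewrite add1n ltnNge leqW //= subSn //= nth_drop subnKC //.
  by rewrite (nth_map ord0) ?size_enum_ord // nth_ord_enum.
rewrite add0n le_ji' nth_take //.
by rewrite (nth_map ord0) ?size_enum_ord // nth_ord_enum.
Qed.

(** A permutation is determined by the preimage [j] of [ord0] and the permutation induced on the
    rest; bijectivity follows from injectivity by counting. *)
Lemma sum_lift_perm k (G : 'S_k.+1 -> K) :
  \sum_t G t = \sum_(t : 'S_k) \sum_(j < k.+1) G (lift_perm j ord0 t).
Proof.
rewrite pair_big /= (reindex (fun p : 'S_k * 'I_k.+1 => lift_perm p.2 ord0 p.1)) //=.
apply: onW_bij; apply: inj_card_bij => [[t j] [t' j'] /= eq_l|]; last first.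
  by rewrite card_prod !card_Sn card_ord factS mulnC.
have eqj : j = j'.
  apply: (@perm_inj _ (lift_perm j' ord0 t')).
  by rewrite lift_perm_id -eq_l lift_perm_id.
rewrite -{j'}eqj in eq_l *; congr (_, _); apply/permP => i.
by apply: (@lift_inj _ ord0); rewrite -!(lift_perm_lift j) eq_l.
Qed.

(** Telescoping: exchanging one factor at a time replaces a linear form by a constant, so the
    difference of the products loses a degree. *)
Lemma msize_prodB_le k (I : eqType) (r : seq I) (P : pred I) (p q : I -> {mpoly K[k]}) :
  (forall i, P i -> (msize (p i) <= 2)%N) ->
  (forall i, P i -> (msize (p i - q i) <= 1)%N) ->
  (msize (\prod_(i <- r | P i) p i - \prod_(i <- r | P i) q i)
   <= \sum_(i <- r | P i) 1)%N.
Proof.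
have szM (a b : {mpoly K[k]}) m n : (msize a <= m.+1)%N -> (msize b <= n)%N ->
    (msize (a * b) <= m + n)%N.
  move=> lea leb.
  have [->|a0] := eqVneq a 0; first by rewrite mul0r msize0.
  have [->|b0] := eqVneq b 0; first by rewrite mulr0 msize0.
  by rewrite msizeM // -ltnS prednK ?addn_gt0 ?lt0n ?msize_poly_eq0 ?a0 // -addSn leq_add.
move=> leP leB; elim: r => [|i r IHr]; first by rewrite !big_nil subrr msize0.
rewrite !big_cons; case: ifP => // Pi.
have leQ : (msize (q i) <= 2)%N.
  have -> : q i = p i - (p i - q i) by rewrite opprB addrC subrK.
  rewrite (leq_trans (msizeD_le _ _)) // geq_max leP // msizeN.
  by rewrite (leq_trans (leB _ Pi)).
set A := \prod_(_ <- r | _) p _ in IHr *; set B := \prod_(_ <- r | _) q _ in IHr *.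
have -> : p i * A - q i * B = q i * (A - B) + A * (p i - q i) by ring.
rewrite (leq_trans (msizeD_le _ _)) // geq_max (szM _ _ 1%N) //=.
rewrite addnC szM ?leB //.
by apply: msize_prod_le.
Qed.

(* The numerator may be translated by the constant y_0, since lower order terms
   vanish; then sum_wpath_insert0 removes the variable whose value is 0. *)
Lemma path_sum k (y : 'I_k.+1 -> K) :
  injective y ->
  \sum_(t : 'S_k.+1) path_num (fun l => y (t l)) / path_den (fun l => y (t l))
  = k`!%:R.
Proof.
elim: k y => [|k IHk] y y_inj.
  rewrite (eq_bigr (fun=> 1)) ?sumr_const ?card_Sn // => t _.
  by rewrite /path_num /path_den !big_pred0 ?divr1 // => -[[]].
have shiftE (t : 'S_k.+2) : path_den (fun l => y (t l)) = path_den (fun l => y (t l) - y ord0).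
  by apply: eq_bigr => l _; rewrite opprB addrA subrK.
pose c := y ord0.
transitivity (\sum_(t : 'S_k.+2) path_num (fun l => y (t l) - c) / path_den (fun l => y (t l))).
  pose X (l : 'I_k.+2) : {mpoly K[k.+2]} := 'X_l.
  apply/eqP; rewrite -subr_eq0 -sumrB.
  (* [q] has degree at most k, less than the k + 1 edges of the path, so [path_vanish] applies. *)
  pose q := path_num X - path_num (fun l => X l - c%:MP).
  have small_q : (msize q < k.+2)%N.
    rewrite ltnS; apply: leq_trans (msize_prodB_le _ _ _) _ => [l _|l _|].
    - rewrite (leq_trans (msize_sum _ _ _)) //; apply/bigmax_leqP_seq => j _ _.
      by rewrite msizeX mdeg1.
    - rewrite sumrB opprB addrC subrK -rmorph_sum /=.
      by rewrite msizeC leq_b1.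
    - by rewrite (big_ord_narrow (leqnSn k.+1)) sum_nat_const card_ord muln1.
  apply/eqP; rewrite -[RHS](path_vanish y_inj small_q); apply: eq_bigr => t _.
  rewrite -mulrBl mevalB; congr ((_ - _) / _);
    rewrite /path_num rmorph_prod /=; apply: eq_bigr => l _;
    rewrite rmorph_sum /=; apply: eq_bigr => j _.
    by rewrite mevalXU.
  by rewrite mevalB mevalXU mevalC.
transitivity (\sum_(t : 'S_k.+2) wpath 0 [seq y (t i) - c | i <- enum 'I_k.+2]).
  by apply: eq_bigr => t _; rewrite shiftE wpath_enum.
rewrite sum_lift_perm.
transitivity (\sum_(t : 'S_k.+1) k.+1%:R *
    wpath 0 [seq y (lift ord0 (t i)) - c | i <- enum 'I_k.+1]).
  apply: eq_bigr => t _.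
  under eq_bigr do rewrite (perm_insert (fun i => y i - c)) subrr.
  set s := [seq _ | _ <- enum 'I_k.+1].
  have sz : size s = k.+1 by rewrite size_map size_enum_ord.
  have s0 : 0 \notin s.
    by apply/mapP => -[i _ /esym /eqP]; rewrite subr_eq0 inj_eq.
  have s_uniq : uniq s.
    rewrite map_inj_uniq ?enum_uniq // => i j /addIr /y_inj /lift_inj.
    exact: perm_inj.
  by case: (s) sz s0 s_uniq => // u w [<-]; apply: sum_wpath_insert0.
rewrite -mulr_sumr factS natrM -(IHk (fun i => y (lift ord0 i) - c)) => [|i j].
  by congr (_ * _); apply: eq_bigr => t _; rewrite wpath_enum.
by move=> /addIr /y_inj /lift_inj.
Qed.

End PathSum.
(** * The blocks of the cycle *)

Section PermExtension.

Variables (k m : nat) (a : 'I_k -> 'I_m).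
Hypothesis a_inj : injective a.

Definition perm_ext_fun (t : 'S_k) v := if [pick l | a l == v] is Some l then a (t l) else v.

Lemma perm_ext_funE t l : perm_ext_fun t (a l) = a (t l).
Proof.
rewrite /perm_ext_fun; case: pickP => [l' /eqP /a_inj -> //|/(_ l)].
by rewrite eqxx.
Qed.

Lemma perm_ext_fun_out t v : v \notin codom a -> perm_ext_fun t v = v.
Proof.
move=> va; rewrite /perm_ext_fun; case: pickP => // l /eqP eq_v.
by rewrite -eq_v codom_f in va.
Qed.

Lemma perm_ext_fun_inj t : injective (perm_ext_fun t).
Proof.
move=> v w; have [/codomP[l ->]|va] := boolP (v \in codom a);
  have [/codomP[l' ->]|wa] := boolP (w \in codom a);
  rewrite ?perm_ext_funE ?perm_ext_fun_out // => eq_vw.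
- by congr a; move/a_inj/perm_inj: eq_vw.
- by rewrite -eq_vw codom_f in wa.
- by rewrite eq_vw codom_f in va.
Qed.

Definition perm_ext t : 'S_m := perm (@perm_ext_fun_inj t).

Lemma perm_extE t l : perm_ext t (a l) = a (t l).
Proof. by rewrite permE perm_ext_funE. Qed.

Lemma perm_ext_out t v : v \notin codom a -> perm_ext t v = v.
Proof. by rewrite permE; apply: perm_ext_fun_out. Qed.

(** Left multiplication by [perm_ext t] permutes 'S_m, so each [t] contributes the full sum. *)
Lemma sum_perm_ext (K : nzRingType) (G : 'S_m -> K) :
  k`!%:R * \sum_s G s = \sum_s \sum_(t : 'S_k) G (perm_ext t * s)%g.
Proof.
rewrite exchange_big [RHS](eq_bigr (fun=> \sum_s G s)) => [|t _].
  by rewrite sumr_const card_Sn mulr_natl.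
by rewrite [RHS](reindex_inj (mulgI (perm_ext t))).
Qed.

End PermExtension.

Lemma iter_cancel T (f g : T -> T) k : cancel f g -> cancel (iter k f) (iter k g).
Proof. by move=> fK; elim: k => [|k IHk] x //; rewrite iterSr /= fK IHk. Qed.

Section Blocks.

Variable m : nat.
Implicit Types (i v : 'I_m) (P : {set 'I_m}).

(* The group of v starts right after the vertex blk P v of P, and v is its
   pos P v-th element; the last element of a group is in P. *)
Definition pos P v : nat := hit (@ord_pred m) P v.
Lemma pos_gt0 P v : (0 < pos P v)%N. Proof. by []. Qed.

Definition blk P v : 'I_m := iter (pos P v) (@ord_pred m) v.

Lemma hit_eq (s : 'I_m -> 'I_m) P i h :
  (0 < h <= m)%N -> iter h s i \in P ->
  (forall k, (0 < k < h)%N -> iter k s i \notin P) -> hit s P i = h.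
Proof.
case: h => // h lt_hm Ph minh.
have [|Phit _ minhit] := @hitP _ s P i; first by exists h.
apply/eqP; rewrite eqn_leq; apply/andP; split; rewrite leqNgt; apply/negP => lt_h.
  by have := minhit h.+1; rewrite lt_h Ph => /(_ isT).
by have := minh (hit s P i); rewrite lt_h Phit => /(_ isT).
Qed.

Lemma iter_ord_pred_m i : iter m (@ord_pred m) i = i.
Proof. by rewrite -{1}(iter_ordS_m i) iter_cancel //; apply: ordSK. Qed.

Section NonEmpty.

Variables (P : {set 'I_m}) (p0 : 'I_m).
Hypothesis p0P : p0 \in P.

Lemma blk_in v : blk P v \in P.
Proof. by have [] := hit_predP v p0P. Qed.

Lemma pos_min v k : (0 < k < pos P v)%N -> iter k (@ord_pred m) v \notin P.
Proof. by have [_ _] := hit_predP v p0P; apply. Qed.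

Lemma pos_lt v : v \notin P -> (pos P v < m)%N.
Proof.
move=> vP; have [] := hit_predP v p0P; rewrite leq_eqVlt -/(pos P v) => Pv.
by case/orP=> // /eqP eq_m; rewrite eq_m iter_ord_pred_m (negPf vP) in Pv.
Qed.

Lemma iter_pos v : iter (pos P v) (@ordS m) (blk P v) = v.
Proof. by apply: iter_cancel; apply: ord_predK. Qed.

Lemma pos_ordS i : pos P (ordS i) = if i \in P then 1%N else (pos P i).+1.
Proof.
have m_gt0 : (0 < m)%N by apply: leq_ltn_trans (ltn_ord i).
have predE k : iter k.+1 (@ord_pred m) (ordS i) = iter k (@ord_pred m) i.
  by rewrite iterSr ordSK.
case: ifP => [iP|/negbT iP]; apply: hit_eq; rewrite ?predE ?pos_lt //.
- by case=> // -[].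
- exact: blk_in.
- by case=> // -[|k] lt_k; rewrite predE // pos_min.
Qed.

Lemma blk_ordS i : blk P (ordS i) = if i \in P then i else blk P i.
Proof.
rewrite /blk pos_ordS; case: ifP => _; first by rewrite /= ordSK.
by rewrite (iterSr (pos P i)) ordSK.
Qed.

Section OneBlock.

Variable p : 'I_m.
Hypothesis pP : p \in P.

(** The group following [p] runs from [ordS p] to the next vertex of [P], whence the shift
    [l.+1]. *)
Definition block (l : 'I_(gap P p)) : 'I_m := iter l.+1 (@ordS m) p.

Lemma block_ordS (l : 'I_(gap P p)) :
  (l.+1 < gap P p)%N -> block (ordS l) = ordS (block l).
Proof. by move=> lt_l; rewrite /block /= modn_small. Qed.

Lemma block_inP (l : 'I_(gap P p)) :
  (block l \in P) = ~~ (l.+1 < gap P p)%N.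
Proof.
have [Pgap _ minP] := gapP pP; have [lt_l|] := boolP (l.+1 < _)%N.
  by apply/negbTE/minP.
rewrite -leqNgt => le_l; rewrite /block (_ : l.+1 = gap P p) //.
by apply/eqP; rewrite eqn_leq le_l ltn_ord.
Qed.

Lemma pos_blk_iter l : (l < gap P p)%N ->
  pos P (iter l.+1 (@ordS m) p) = l.+1 /\ blk P (iter l.+1 (@ordS m) p) = p.
Proof.
elim: l => [|l IHl] lt_l; first by rewrite /= pos_ordS blk_ordS pP.
have [posl blkl] := IHl (ltnW lt_l); have [_ _ minP] := gapP pP.
by rewrite iterS pos_ordS blk_ordS (negbTE (minP _ _)) // posl.
Qed.

Lemma pos_block (l : 'I_(gap P p)) : pos P (block l) = l.+1.
Proof. by case: (pos_blk_iter (ltn_ord l)). Qed.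

Lemma blk_block (l : 'I_(gap P p)) : blk P (block l) = p.
Proof. by case: (pos_blk_iter (ltn_ord l)). Qed.

Lemma block_inj : injective block.
Proof. by move=> l l' eq_b; apply/val_inj/succn_inj; rewrite -!pos_block eq_b. Qed.

Lemma mem_codom_block v : (v \in codom block) = (blk P v == p).
Proof.
apply/codomP/eqP => [[l ->]|eq_p]; first exact: blk_block.
have [Pgap _ _] := gapP pP.
(* Otherwise the walk back from [v] to [p] would first meet the vertex of [P] that follows [p]. *)
have le_pos : (pos P v <= gap P p)%N.
  rewrite leqNgt; apply/negP => lt_gap; have := @pos_min v (pos P v - gap P p).
  have -> : iter (pos P v - gap P p) (@ord_pred m) v = iter (gap P p) (@ordS m) p.
    apply: (canLR (iter_cancel _ (@ordSK m))).
    by rewrite -iterD (subnK (ltnW lt_gap)) -[LHS]iter_pos eq_p.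
  by rewrite Pgap subn_gt0 lt_gap ltn_subrL pos_gt0 => /(_ isT).
have le_pos1 : ((pos P v).-1 < gap P p)%N by rewrite prednK ?pos_gt0.
exists (Ordinal le_pos1).
by rewrite /block (prednK (pos_gt0 P v)) -[LHS]iter_pos eq_p.
Qed.

Lemma big_block (R : Type) (idx : R) (op : Monoid.com_law idx) (F : 'I_m -> R) :
  \big[op/idx]_(v | blk P v == p) F v = \big[op/idx]_l F (block l).
Proof.
rewrite (eq_bigl (fun v => v \in codom block)) => [|v]; last by rewrite mem_codom_block.
rewrite -big_uniq; last by rewrite map_inj_uniq ?enum_uniq //; apply: block_inj.
by rewrite big_image.
Qed.

End OneBlock.

Lemma big_blocks (R : Type) (idx : R) (op : Monoid.com_law idx) (F : 'I_m -> R) :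
  \big[op/idx]_v F v = \big[op/idx]_(p in P) \big[op/idx]_l F (@block p l).
Proof.
rewrite (partition_big (blk P) (mem P)) => [|v _]; last exact: blk_in.
by apply: eq_bigr => p pP; rewrite big_block.
Qed.

End NonEmpty.

End Blocks.

(** * Partial sums over the groups, and the denominator of the cut cycle *)

Section PartialSums.

Variables (R : comNzRingType) (m : nat).
Implicit Types (P : {set 'I_m}) (y : 'I_m -> R) (v : 'I_m).

(** Unlike [zval], it keeps its meaning on [P], where it is the sum over the whole group and hence
    symmetric in it. *)
Definition zsum P y v : R := \sum_(j < pos P v) y (iter j (@ord_pred m) v).

Definition zval P y v : R := if v \in P then 1 else zsum P y v.

(** The denominator, up to sign, of the paths left when the edges from each p in [P] to p + 1 are
    removed. *)
Definition cut_den P y : R := \prod_(v | v \notin P) (y v - y (ordS v)).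

Lemma zsum_ordS P p0 y v : p0 \in P ->
  zsum P y (ordS v) = y (ordS v) + (if v \in P then 0 else zsum P y v).
Proof.
move=> p0P; rewrite /zsum (pos_ordS p0P); case: ifP => _.
  by rewrite big_ord1 addr0.
rewrite big_ord_recl; congr (_ + _); apply: eq_bigr => j _.
by rewrite (iterSr j) ordSK.
Qed.

Lemma eq_zsum P y y' v : y =1 y' -> zsum P y v = zsum P y' v.
Proof. by move=> eq_y; apply: eq_bigr. Qed.

Lemma eq_zval P y y' v : y =1 y' -> zval P y v = zval P y' v.
Proof. by move=> eq_y; rewrite /zval (eq_zsum _ _ eq_y). Qed.

Section Block.

Variables (P : {set 'I_m}) (p : 'I_m).
Hypothesis pP : p \in P.

Lemma zsum_block y (l : 'I_(gap P p)) :
  zsum P y (block l) = \sum_(j < gap P p | (j <= l)%N) y (block j).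
Proof.
have lt_l : (l.+1 <= gap P p)%N by [].
rewrite [RHS](big_ord_narrow lt_l) /zsum (pos_block pP pP).
(* [zsum] is summed backwards from [block l], hence the reversal of the index. *)
rewrite [RHS](reindex_inj rev_ord_inj); apply: eq_bigr => j _.
have lE : l.+1 = (j + (rev_ord j).+1)%N by rewrite /= -subSn // subSS subnKC // ltnW.
transitivity (y (iter j (@ord_pred m) (iter (j + (rev_ord j).+1) (@ordS m) p))).
  by rewrite -lE.
by rewrite iterD iter_cancel //; apply: ordSK.
Qed.

Lemma zsum_block_last y (l : 'I_(gap P p)) :
  block l \in P -> zsum P y (block l) = \sum_(w | blk P w == p) y w.
Proof.
rewrite (block_inP pP) -leqNgt zsum_block (big_block pP pP) => le_l.
by apply: eq_bigl => j; rewrite -ltnS (leq_trans (ltn_ord j)).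
Qed.

Lemma cut_den_block y :
  cut_den P y = path_den (fun l => y (@block _ P p l)) *
    \prod_(v | (blk P v != p) && (v \notin P)) (y v - y (ordS v)).
Proof.
rewrite /cut_den (bigID (fun v => blk P v == p)) /=.
congr (_ * _); last by apply: eq_bigl => v; rewrite andbC.
rewrite big_mkcondl /= (big_block pP pP) -big_mkcond.
apply: eq_big => [l|l lt_l]; first by rewrite (block_inP pP) negbK.
by rewrite block_ordS // -(negbK (_ < _)%N) -(block_inP pP).
Qed.

End Block.

Lemma zsum_last P y v :
  v \in P -> zsum P y v = \sum_(w | blk P w == blk P v) y w.
Proof.
move=> vP; have bP := blk_in vP v.
have /codomP[l eq_v] : v \in codom (@block _ P (blk P v)).
  by rewrite (mem_codom_block vP bP).
transitivity (zsum P y (block l)); first by rewrite -eq_v.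
by rewrite zsum_block_last // -eq_v.
Qed.

End PartialSums.

Lemma rmorph_zsum (R S : comNzRingType) (f : {rmorphism R -> S}) m P (y : 'I_m -> R) v :
  f (zsum P y v) = zsum P (fun w => f (y w)) v.
Proof. exact: rmorph_sum. Qed.

Lemma rmorph_zval (R S : comNzRingType) (f : {rmorphism R -> S}) m P (y : 'I_m -> R) v :
  f (zval P y v) = zval P (fun w => f (y w)) v.
Proof. by rewrite /zval; case: ifP => _; rewrite ?rmorph1 ?rmorph_zsum. Qed.
(** * Symmetrization over the cut cycle *)

Section Symmetrization.

Variables (K : fieldType) (m : nat) (x : 'I_m -> K).
Hypothesis K_char0 : forall k, k.+1%:R != 0 :> K.
Hypothesis x_inj : injective x.

Lemma natr_neq0 k : (0 < k)%N -> k%:R != 0 :> K.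
Proof. by case: k. Qed.

Section Block.

Variables (P : {set 'I_m}) (p : 'I_m).
Hypothesis pP : p \in P.

Lemma blk_perm_ext t v : blk P (perm_ext (block_inj pP pP) t v) = blk P v.
Proof.
have [/codomP[l ->]|vp] := boolP (v \in codom (@block _ P p)).
  by rewrite perm_extE !(blk_block pP pP).
by rewrite perm_ext_out.
Qed.

(* Averaging over the permutations of the values within one block. *)
Lemma sum_block_split (F : ('I_(gap P p) -> K) -> K) (R : ('I_m -> K) -> K) (b : K) :
  (forall y z, y =1 z -> F y = F z) ->
  (forall t y z, (forall v, z v = y (perm_ext (block_inj pP pP) t v)) -> R z = R y) ->
  (forall y : 'I_(gap P p) -> K, injective y ->
    \sum_(t : 'S_(gap P p)) F (fun l => y (t l)) = b) ->
  (gap P p)`!%:R * (\sum_(s : 'S_m) F (fun l => x (s (block l))) * R (fun v => x (s v)))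
  = b * \sum_(s : 'S_m) R (fun v => x (s v)).
Proof.
move=> F_ext R_sym sumF; rewrite (sum_perm_ext (block_inj pP pP)) mulr_sumr.
apply: eq_bigr => s _.
rewrite -(sumF (fun l => x (s (block l)))) => [|l l' /x_inj /perm_inj /(block_inj pP pP) //].
rewrite mulr_suml; apply: eq_bigr => t _; congr (_ * _).
  by apply: F_ext => l; rewrite permM perm_extE.
by apply: (R_sym t) => v; rewrite permM.
Qed.

End Block.

(** [m - #|P|] is the total number of edges of the paths, so each monomial of [q] has, in some
    block, degree smaller than its number of edges, and [path_vanish] applies there. [S] is an extra
    block-symmetric factor, which costs no degree. *)
Lemma sum_cut_vanish (P : {set 'I_m}) p0 (q : {mpoly K[m]}) (S : ('I_m -> K) -> K) :
  p0 \in P -> (msize q <= m - #|P|)%N ->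
  (forall (f : 'S_m) y z, (forall v, blk P (f v) = blk P v) ->
     (forall v, z v = y (f v)) -> S z = S y) ->
  \sum_(s : 'S_m) q.@[fun v => x (s v)] * S (fun v => x (s v))
     / cut_den P (fun v => x (s v)) = 0.
Proof.
move=> p0P small_q S_sym.
under eq_bigr do rewrite mevalE -mulrA mulr_suml.
rewrite exchange_big /= big_seq big1 // => c c_supp.
under eq_bigr do rewrite -mulrA; rewrite -mulr_sumr.
suff -> : \sum_(s : 'S_m) (\prod_v x (s v) ^+ c v) *
    (S (fun v => x (s v)) / cut_den P (fun v => x (s v))) = 0 by rewrite mulr0.
have lt_c : (mdeg c + #|P| < m)%N.
  by rewrite addnC -ltn_subRL (leq_trans (msize_mdeg_lt c_supp)).
have [p pP lt_cp] : exists2 p, p \in P & ((\sum_l c (@block _ P p l)).+1 < gap P p)%N.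
  apply/exists_inP; apply: contraLR lt_c; rewrite negb_exists_in => /forall_inP le_gap.
  have mE : m = (\sum_(p in P) gap P p)%N.
    rewrite -[LHS]card_ord -sum1_card (big_blocks p0P).
    by apply: eq_bigr => p pP; rewrite sum1_card card_ord.
  rewrite -leqNgt {1}mE mdegE (big_blocks p0P) -sum1_card -big_split /=.
  by apply: leq_sum => p pP; rewrite addn1 leqNgt le_gap.
(* [F] collects what depends on the values in the block of [p], [R] everything else, as in
   [sum_block_split]. *)
pose c' : 'X_{1..gap P p} := [multinom c (block l) | l < gap P p].
pose F y := ('X_[c'] : {mpoly K[gap P p]}).@[y] / path_den y.
pose R y := (\prod_(v | blk P v != p) y v ^+ c v) * S y /
  \prod_(v | (blk P v != p) && (v \notin P)) (y v - y (ordS v)).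
have cE y : \prod_v y v ^+ c v * (S y / cut_den P y)
    = F (fun l => y (block l)) * R y.
  rewrite (bigID (fun v => blk P v == p)) /= (big_block pP pP) (cut_den_block pP).
  rewrite /F /R invfM mevalX.
  by rewrite (eq_bigr (fun l => y (@block _ P p l) ^+ c' l)) => [|l _]; [ring | rewrite mnmE].
under eq_bigr do rewrite cE.
apply: (mulfI (natr_neq0 (fact_gt0 (gap P p)))); rewrite mulr0.
rewrite (@sum_block_split _ _ pP F R 0) ?mul0r //.
- move=> y z eq_yz; rewrite /F (meval_eq _ eq_yz); congr (_ / _).
  by apply: eq_bigr => l _; rewrite !eq_yz.
- move=> t y z zE.
  have zE' v : blk P v != p -> z v = y v.
    by rewrite zE -(mem_codom_block pP pP) => vp; rewrite perm_ext_out.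
  rewrite /R; congr (_ * _ / _); first by apply: eq_bigr => v vp; rewrite zE'.
    by apply: (S_sym (perm_ext (block_inj pP pP) t)) => // v; apply: blk_perm_ext.
  apply: eq_bigr => v /andP[vp vP]; rewrite !zE' //.
  by rewrite (blk_ordS pP) (negPf vP).
- move=> y y_inj; apply: path_vanish => //.
  rewrite msizeX mdegE; apply: leq_ltn_trans lt_cp; rewrite ltnS.
  by apply: leq_sum => l _; rewrite mnmE.
Qed.

(** The origin of the weight: a block of size k has path sum (k - 1)!, and its size completes this
    to k!. *)
Lemma path_sum_gap k (y : 'I_k -> K) : (0 < k)%N -> injective y ->
  k%:R * \sum_(t : 'S_k) path_num (fun l => y (t l)) / path_den (fun l => y (t l)) = k`!%:R.
Proof. by case: k y => // k y _ y_inj; rewrite path_sum // -natrM -factS. Qed.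

(** The summand is a product over blocks. Averaging over the permutations of one block turns its
    factor into the inverse of its size, which cancels against the weight. *)
Lemma sum_complement (Q : {set 'I_m}) q0 : q0 \in Q ->
  (weight Q)%:R * \sum_(s : 'S_m)
    (\prod_(v | v \notin Q) zsum Q (fun w => x (s w)) v) / cut_den Q (fun v => x (s v))
  = m`!%:R.
Proof.
move=> q0Q.
pose f p y := path_num (fun l => y (@block _ Q p l)) / path_den (fun l => y (@block _ Q p l)) : K.
have fE y : (\prod_(v | v \notin Q) zsum Q y v) / cut_den Q y = \prod_(p <- enum Q) f p y.
  rewrite [RHS]big_enum -prodf_div big_mkcond (big_blocks q0Q); apply: eq_bigr => p pQ.
  rewrite /f /path_num /path_den -prodf_div [RHS]big_mkcond; apply: eq_bigr => l _.
  rewrite (block_inP pQ) negbK; case: ifP => // lt_l.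
  by rewrite (zsum_block pQ) // block_ordS.
under eq_bigr do rewrite fE.
have -> : weight Q = (\prod_(p <- enum Q) gap Q p)%N by rewrite big_enum.
have : {subset enum Q <= Q} by move=> p; rewrite mem_enum.
(* Blocks are averaged out one at a time, hence the induction over a duplicate-free list of vertices
   of [Q]. *)
elim: (enum Q) (enum_uniq Q) => [_ _|p r IHr /= /andP[pr r_uniq] rQ].
  by rewrite big_nil mul1r (eq_bigr (fun=> 1)) ?sumr_const ?card_Sn // => s _; rewrite big_nil.
have pQ : p \in Q by rewrite rQ ?mem_head.
rewrite -(IHr r_uniq) => [|p' p'r]; last by rewrite rQ ?in_cons ?p'r ?orbT.
rewrite big_cons natrM -mulrA mulrCA; congr (_ * _).
under eq_bigr do rewrite big_cons.
pose F (y : 'I_(gap Q p) -> K) := path_num y / path_den y.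
pose R y := \prod_(p' <- r) f p' y.
have g0 : (gap Q p)%:R != 0 :> K by apply: natr_neq0.
apply: (mulfI (natr_neq0 (fact_gt0 (gap Q p)))); rewrite mulrCA.
rewrite (@sum_block_split _ _ pQ F R ((gap Q p)`!%:R / (gap Q p)%:R)).
- by rewrite mulrA mulrCA mulfV // mulr1.
- by move=> y z eq_yz; congr (_ / _); apply: eq_bigr => l _; rewrite ?eq_yz //; apply: eq_bigr.
- move=> t y z zE; rewrite /R big_seq [RHS]big_seq; apply: eq_bigr => p' p'r.
  have p'Q : p' \in Q by rewrite rQ ?in_cons ?p'r ?orbT.
  have zE' l : z (@block _ Q p' l) = y (block l).
    rewrite zE perm_ext_out // (mem_codom_block pQ pQ) (blk_block pQ) //.
    by apply: contraNneq pr => <-.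
  by rewrite /f; congr (_ / _); apply: eq_bigr => l _; rewrite ?zE' //; apply: eq_bigr.
- move=> y y_inj; apply: (mulfI g0); rewrite [in LHS]path_sum_gap //.
  by rewrite mulrCA mulfV // mulr1.
Qed.

End Symmetrization.

(** * The harmonic relation and the sum over all P in characteristic 0 *)

Section Harmonic.

Variables (K : fieldType) (m : nat) (x : 'I_m -> K).
Hypothesis K_char0 : forall k, k.+1%:R != 0 :> K.
Hypothesis x_inj : injective x.
Implicit Types (P : {set 'I_m}) (c : 'X_{1..m}).

Local Notation xs s := (fun v => x (s v)).

Definition zmono (R : comNzRingType) P c (y : 'I_m -> R) : R := \prod_v zval P y v ^+ c v.

(** The contribution of [P] for the monomial with exponents [c], up to the sign found in
    [cycle_num_den]. *)
Definition cut_sum P c : K :=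
  (weight P)%:R * \sum_(s : 'S_m) zmono P c (xs s) / cut_den P (xs s).

Definition zpoly P c : {mpoly K[m]} := zmono P c (fun j => 'X_j).

Lemma zpolyE P c y : (zpoly P c).@[y] = zmono P c y.
Proof.
rewrite /zpoly /zmono rmorph_prod; apply: eq_bigr => v _.
by rewrite rmorphXn /= rmorph_zval; congr (_ ^+ _); apply: eq_zval => w; rewrite /= mevalXU.
Qed.

Lemma zmonoD (R : comNzRingType) P c1 c2 (y : 'I_m -> R) :
  zmono P (c1 + c2)%MM y = zmono P c1 y * zmono P c2 y.
Proof. by rewrite -big_split; apply: eq_bigr => v _; rewrite mnmDE exprD. Qed.

Lemma zmonoU (R : comNzRingType) P v (y : 'I_m -> R) : zmono P U_(v)%MM y = zval P y v.
Proof.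
rewrite /zmono (bigD1 v) //= big1 ?mulr1 => [|w ne_wv]; rewrite mnm1E ?eqxx //.
by rewrite eq_sym (negPf ne_wv).
Qed.

(** Exponents on [P] do not count, since z is 1 there; elsewhere z is a linear form. *)
Lemma msize_zpoly P c : (msize (zpoly P c) <= (\sum_(v | v \notin P) c v).+1)%N.
Proof.
rewrite [X in (_ <= X.+1)%N]big_mkcond; apply: msize_prod_le => v _.
rewrite /zval; case: ifP => [vP|_]; first by rewrite expr1n msize1.
rewrite -[c v]card_ord -prodr_const -sum1_card.
apply: msize_prod_le => j _; rewrite (leq_trans (msize_sum _ _ _)) //.
by apply/bigmax_leqP_seq => w _ _; rewrite msizeX mdeg1.
Qed.

Lemma mdeg_split P c :
  mdeg c = (\sum_(v in P) c v + \sum_(v | v \notin P) c v)%N.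
Proof. by rewrite mdegE (bigID (mem P)). Qed.

Lemma zmono_vanish P p0 c : p0 \in P ->
  (\sum_(v | v \notin P) c v < m - #|P|)%N ->
  \sum_(s : 'S_m) zmono P c (xs s) / cut_den P (xs s) = 0.
Proof.
move=> p0P lt_c.
have small_q := leq_trans (msize_zpoly P c) lt_c.
rewrite -[RHS](sum_cut_vanish K_char0 x_inj (S := fun=> 1) p0P small_q) //.
by apply: eq_bigr => s _; rewrite zpolyE mulr1.
Qed.

(** For [e] in [P] the sum runs over a whole group, so it can serve as the factor [S] of
    [sum_cut_vanish]. *)
Lemma zsum_vanish P e (q : {mpoly K[m]}) : e \in P -> (msize q <= m - #|P|)%N ->
  \sum_(s : 'S_m) q.@[xs s] * zsum P (xs s) e / cut_den P (xs s) = 0.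
Proof.
move=> eP small_q; apply: (sum_cut_vanish (S := fun y => zsum P y e) _ _ eP) => //.
move=> f y z fP zE; rewrite !zsum_last // [RHS](reindex_inj (@perm_inj _ f)) /=.
by apply: eq_big => [v|v _]; rewrite ?fP ?zE.
Qed.

Lemma cut_den_cut P i (y : 'I_m -> K) : i \notin P ->
  cut_den P y = (y i - y (ordS i)) * cut_den (i |: P) y.
Proof.
move=> iP; rewrite /cut_den (bigD1 i) //=; congr (_ * _); apply: eq_bigl => v.
by rewrite !inE negb_or andbC.
Qed.

Lemma zsum_cut P p0 i (y : 'I_m -> K) : p0 \in P -> i \notin P ->
  zsum (i |: P) y i = zsum P y i.
Proof.
move=> p0P iP; rewrite /zsum.
suff -> : pos (i |: P) i = pos P i by [].
have pos_m := pos_lt p0P iP.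
apply: hit_eq; first by rewrite pos_gt0 ltnW.
  by rewrite inE (blk_in p0P i) orbT.
move=> k /andP[k_gt0 lt_k]; rewrite !inE negb_or (pos_min p0P) ?k_gt0 // andbT.
(* Fewer than [m] steps, but at least one, cannot lead back to [i]. *)
apply/eqP => /(canRL (iter_cancel k (@ord_predK m))) /(congr1 val).
rewrite val_iter_ordS; have := ltn_ord i; have := ltn_trans lt_k pos_m.
case: (ltnP (i + k) m) => [lt_m|le_m] lt_km lt_im; first by rewrite modn_small //= ; lia.
by rewrite -(subnK le_m) modnDr modn_small /=; lia.
Qed.

(** This holds for each [P] separately. When [i] is not in [P], the second difference yields y_i -
    y_(i+1), which cancels an edge and replaces [P] by [i |: P]. One factor z_i is then the sum over
    a whole group, and the other factors have too small a degree. *)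
Lemma cut_sum_harmonic P p0 c j : p0 \in P -> ((mdeg c).+1 = m - #|P|)%N ->
  (0 < c (ordS j))%N ->
  2 * cut_sum P (c + U_(ordS j))
  = cut_sum P (c + U_(j)) + cut_sum P (c + U_(ordS (ordS j))).
Proof.
move=> p0P deg_c; set i := ordS j => ci_gt0.
have le_c : (\sum_(v | v \notin P) c v <= mdeg c)%N by rewrite (mdeg_split P) leq_addl.
rewrite /cut_sum mulrCA -mulrDr; congr (_ * _).
have [iP|iP] := boolP (i \in P).
  (* The exponent at [i] is spent on z_i = 1, so all three terms have too small a degree. *)
  have vanish v : \sum_(s : 'S_m) zmono P (c + U_(v)) (xs s) / cut_den P (xs s) = 0.
    apply: (zmono_vanish iP); rewrite -deg_c ltnS.
    under eq_bigr do rewrite mnmDE; rewrite big_split /=.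
    rewrite [X in (_ <= X)%N](mdeg_split P) addnC leq_add2r.
    apply: (@leq_trans (c i)); last by rewrite (bigD1 i) //= leq_addr.
    apply: leq_trans ci_gt0; rewrite -(mdeg1 v).
    by rewrite [X in (_ <= X)%N](mdeg_split P) leq_addl.
  by rewrite !vanish mulr0 addr0.
apply/eqP; rewrite -subr_eq0 mulr_sumr -big_split -sumrB /=.
pose M s := zmono P c (xs s).
pose i' := ordS i.
(* z_i - z_j = y i (without z_j if j is in P), and z_i' - z_i = y i' unless i'
   is in P, where zsum P y i', not z_i' = 1, has this property. *)
rewrite (eq_bigr (fun s : 'S_m => M s * (xs s i - xs s i') / cut_den P (xs s)
   + (i' \in P)%:R * (M s * zsum P (xs s) i' / cut_den P (xs s))
   - ((i' \in P)%:R + (j \in P)%:R) * (M s / cut_den P (xs s)))); last first.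
  move=> s _; rewrite !zmonoD !zmonoU -/(M s) /zval (negPf iP).
  rewrite (zsum_ordS _ _ p0P) (negPf iP) (zsum_ordS _ j p0P) -/i -/i'.
  by case: ifP => _; case: ifP => _ /=; ring.
rewrite sumrB big_split /= -!mulr_sumr.
have lt_c : (\sum_(v | v \notin P) c v < m - #|P|)%N by rewrite -deg_c ltnS.
rewrite (zmono_vanish p0P lt_c) mulr0 subr0.
have -> : (i' \in P)%:R * (\sum_(s : 'S_m) M s * zsum P (xs s) i' / cut_den P (xs s)) = 0.
  have [i'P|_] := boolP (i' \in P); last by rewrite mul0r.
  rewrite mul1r -[RHS](zsum_vanish (q := zpoly P c) i'P).
    by apply: eq_bigr => s _; rewrite zpolyE.
  exact: leq_trans (msize_zpoly P c) lt_c.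
rewrite addr0; have iP' : i \in i |: P by exact: setU11.
have cE : c = (c - U_(i) + U_(i))%MM by rewrite submK // lep1mP -lt0n.
have small_q : (msize (zpoly P (c - U_(i))) <= m - #|i |: P|)%N.
  rewrite (leq_trans (msize_zpoly _ _)) // cardsU1 iP add1n subnS -deg_c /=.
  by rewrite [X in (_ <= X)%N](congr1 (@mdeg m) cE) mdegD mdeg1 addn1 ltnS (mdeg_split P) leq_addl.
apply/eqP; rewrite -[RHS](zsum_vanish iP' small_q); apply: eq_bigr => s _.
rewrite zpolyE /M {1}cE zmonoD zmonoU /zval (negPf iP) (zsum_cut _ p0P iP).
rewrite (cut_den_cut _ iP) invfM.
have : xs s i - xs s i' != 0.
  rewrite subr_eq0 (inj_eq x_inj) (inj_eq perm_inj) /i'.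
  (* A fixed point [ordS i = i] would give [pos P i = (pos P i).+1]. *)
  apply/eqP => eq_i; have := pos_ordS p0P i.
  by rewrite -eq_i (negPf iP) => /n_Sn.
by move: (cut_den _ _)^-1 => D y0; field.
Qed.

(** Zero second differences and a zero start give [u k = k%:R * u 1]; the other end forces
    [u 1 = 0], as [T.+1] is nonzero in [K]. *)
Lemma affine_zero T (u : nat -> K) : u 0%N = 0 -> u T.+1 = 0 ->
  (forall k, (k < T)%N -> 2 * u k.+1 = u k + u k.+2) ->
  forall k, (k <= T.+1)%N -> u k = 0.
Proof.
move=> u0 uT u_aff.
have uE k : (k <= T)%N -> u k = k%:R * u 1%N /\ u k.+1 = k.+1%:R * u 1%N.
  elim: k => [|k IHk] lt_kT; first by rewrite u0 mul0r mul1r.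
  have [uk uk1] := IHk (ltnW lt_kT); split=> //.
  rewrite -[LHS](addKr (u k)) -u_aff // uk uk1 !mulrSr.
  ring.
have u1 : u 1%N = 0.
  have [_] := uE T (leqnn T); rewrite uT => /esym /eqP.
  by rewrite mulf_eq0 (negPf (K_char0 _)) => /eqP.
by case=> [|k] le_kT; rewrite ?u0 // (uE k le_kT).2 u1 mulr0.
Qed.

Lemma mdeg_le1 c : (forall v, c v <= 1)%N ->
  (mdeg c + #|[set v | c v == 0%N]| = m)%N.
Proof.
move=> c_le1; rewrite mdegE -sum1_card [X in (_ + X)%N]big_mkcond -big_split /=.
rewrite (eq_bigr (fun=> 1%N)) ?sum1_card ?card_ord // => v _.
by rewrite inE; case: (c v) (c_le1 v) => [|[]].
Qed.

(** If [P] is not the zero set of [c], some p in [P] wastes an exponent on z_p = 1, and the degree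
    left outside [P] is too small. Otherwise [sum_complement] gives the value. *)
Lemma cut_sum_complement P c : (0 < #|P|)%N -> (forall v, c v <= 1)%N ->
  #|P| = #|[set v | c v == 0%N]| ->
  cut_sum P c = if P == [set v | c v == 0%N] then m`!%:R else 0.
Proof.
case/card_gt0P=> p0 p0P c_le1 cardP; set Q := [set v | _] in cardP *.
have cE v : c v = (v \notin Q) by rewrite inE; case: (c v) (c_le1 v) => [|[]].
case: eqP => [eq_PQ|/eqP ne_PQ].
  rewrite -(sum_complement K_char0 x_inj p0P) /cut_sum; congr (_ * _).
  apply: eq_bigr => s _; congr (_ / _); rewrite /zmono [RHS]big_mkcond.
  apply: eq_bigr => v _; rewrite cE -eq_PQ /zval.
  by case: (v \in P); rewrite ?expr1.
have [p pP pQ] : exists2 p, p \in P & p \notin Q.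
  by apply/subsetPn; apply: contraNN ne_PQ => sPQ; rewrite eqEcard sPQ cardP leqnn.
rewrite /cut_sum (zmono_vanish p0P) ?mulr0 //.
have : (\sum_(v | v \notin P) c v < mdeg c)%N.
  by rewrite (mdeg_split P) -[X in (X < _)%N]add0n ltn_add2r (bigD1 p) //= cE pQ.
suff -> : mdeg c = (m - #|P|)%N by [].
by rewrite cardP; apply/esym/(canLR (addnK _)); rewrite mdeg_le1.
Qed.

Variable d : nat.
Hypothesis d_gt0 : (0 < d)%N.

(* Induction on the number of zeros of c: if c_j > 1, take for N the vector
   c - e_j; L (N + e_v) is affine on the run of the support of N around j, and
   it vanishes at both ends, where N + e_v has fewer zeros than c. *)
Lemma sum_cut_sum c : (mdeg c + d = m)%N ->
  \sum_(P : {set 'I_m} | #|P| == d) cut_sum P c = m`!%:R.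
Proof.
(* Subtracting the constant m! turns the claim into [L c = 0] and preserves harmonicity. *)
pose L c' := \sum_(P : {set 'I_m} | #|P| == d) cut_sum P c' - m`!%:R.
move=> deg_c; apply/eqP; rewrite -subr_eq0 -/(L c); apply/eqP.
pose Z c' := [set v : 'I_m | c' v == 0%N].
move: {2}#|Z c|.+1 (ltnSn #|Z c|) => b.
elim: b => // b IHb in c deg_c *; rewrite ltnS => le_Zb.
have [/forallP c_le1|] := boolP [forall v, c v <= 1]%N.
  have cardQ : #|Z c| = d.
    by apply: (@addnI (mdeg c)); rewrite deg_c mdeg_le1.
  apply/eqP; rewrite subr_eq0 (bigD1 (Z c)) ?cardQ //=.
  rewrite cut_sum_complement ?cardQ // eqxx big1 ?addr0 // => P /andP[/eqP cardP /negPf ne_P].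
  by rewrite cut_sum_complement ?cardP // ne_P.
rewrite negb_forall => /existsP[j]; rewrite -ltnNge => cj_gt1.
pose N := (c - U_(j))%MM.
have cE : c = (N + U_(j))%MM by rewrite submK // lep1mP -lt0n ltnW.
have degN1 : (mdeg N).+1 = mdeg c by rewrite [in RHS]cE mdegD mdeg1 addn1.
have deg_N : (mdeg N).+1 = (m - d)%N.
  by apply/esym/(canLR (addnK _)); rewrite degN1 deg_c.
have ZN : Z N = Z c.
  apply/setP => v; rewrite !inE [in RHS]cE mnmDE mnm1E.
  case: (eqVneq j v) => [<-|_]; last by rewrite addn0.
  by rewrite mnmBE mnm1E eqxx addn1; move: cj_gt1; case: (c j) => [|[]].
(* The degree of [N] is less than [m]. *)
have [p0 p0Z] : exists p0, p0 \in Z N.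
  apply/card_gt0P; rewrite card_gt0; apply/eqP => Z0.
  suff : (m <= mdeg N)%N by rewrite -ltnS deg_N ltnNge leq_subr.
  rewrite -[X in (X <= _)%N]card_ord -sum1_card mdegE; apply: leq_sum => v _.
  by rewrite lt0n; have := in_set0 v; rewrite -Z0 inE => ->.
(* [p] is the zero of [N] just before the run containing [j]; [u] follows this run from [p] to the
   next zero, possibly [p] again. *)
have pZ := blk_in p0Z j; set p := blk (Z N) j in pZ.
pose u k := L (N + U_(iter k (@ordS m) p))%MM.
have u_end v : v \in Z N -> L (N + U_(v))%MM = 0.
  move=> vZ; apply: IHb; first by rewrite mdegD mdeg1 addn1 degN1.
  apply: leq_trans le_Zb; rewrite -ZN; apply: proper_card; apply/properP; split.
    by apply/subsetP => w; rewrite !inE mnmDE addn_eq0 => /andP[].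
  by exists v => //; rewrite inE mnmDE mnm1E eqxx addn1.
have [Pgap _ minP] := gapP pZ.
have u0 := affine_zero (u := u) (T := (gap (Z N) p).-1) (u_end _ pZ) (u_end _ Pgap) _.
have /codomP[l jE] : j \in codom (@block _ (Z N) p) by rewrite (mem_codom_block p0Z pZ).
rewrite cE jE; apply: (u0 _ l.+1) => // k lt_k.
rewrite /u /L mulrBr mulr_sumr.
under eq_bigr => P /eqP cardP.
  have /card_gt0P[q qP] : (0 < #|P|)%N by rewrite cardP.
  rewrite [iter k.+1 _ _]/= (cut_sum_harmonic qP) ?cardP //; last first.
    rewrite lt0n; have := minP k.+1; rewrite inE; apply.
    exact: lt_k.
  over.
rewrite big_split /=; ring.
Qed.

End Harmonic.
(** * Transfer from characteristic 0 *)

Section CycleSummand.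

Variable m : nat.
Implicit Types (P : {set 'I_m}) (c : 'X_{1..m}).

(** Taken over any ring and any values [y], so that ring morphisms carry one instance to another. *)
Definition cycle_num (R : comNzRingType) P c (y : 'I_m -> R) : R :=
  (\prod_(p in P) (y (ordS p) - y p)) * zmono P c y.

Definition cycle_den (R : comNzRingType) (y : 'I_m -> R) : R :=
  \prod_(e <- cycle_edges m) (y e.1 - y e.2).

Lemma eq_zmono (R : comNzRingType) P c (y z : 'I_m -> R) :
  y =1 z -> zmono P c y = zmono P c z.
Proof. by move=> eq_yz; apply: eq_bigr => v _; rewrite (eq_zval _ _ eq_yz). Qed.

Lemma eq_cycle_num (R : comNzRingType) P c (y z : 'I_m -> R) :
  y =1 z -> cycle_num P c y = cycle_num P c z.
Proof.
move=> eq_yz; congr (_ * _); last exact: eq_zmono.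
by apply: eq_bigr => p _; rewrite !eq_yz.
Qed.

Lemma eq_cycle_den (R : comNzRingType) (y z : 'I_m -> R) :
  y =1 z -> cycle_den y = cycle_den z.
Proof. by move=> eq_yz; apply: eq_bigr => e _; rewrite !eq_yz. Qed.

Lemma rmorph_zmono (R S : comNzRingType) (f : {rmorphism R -> S}) P c (y : 'I_m -> R) :
  f (zmono P c y) = zmono P c (fun v => f (y v)).
Proof.
by rewrite rmorph_prod; apply: eq_bigr => v _; rewrite rmorphXn /= rmorph_zval.
Qed.

Lemma rmorph_cycle_num (R S : comNzRingType) (f : {rmorphism R -> S}) P c (y : 'I_m -> R) :
  f (cycle_num P c y) = cycle_num P c (fun v => f (y v)).
Proof.
rewrite rmorphM rmorph_zmono rmorph_prod; congr (_ * _).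
by apply: eq_bigr => p _; rewrite rmorphB.
Qed.

Lemma rmorph_cycle_den (R S : comNzRingType) (f : {rmorphism R -> S}) (y : 'I_m -> R) :
  f (cycle_den y) = cycle_den (fun v => f (y v)).
Proof. by rewrite rmorph_prod; apply: eq_bigr => e _; rewrite rmorphB. Qed.

Hypothesis m_gt1 : (1 < m)%N.

Lemma ordS_neq (v : 'I_m) : ordS v != v.
Proof.
apply/eqP => /(congr1 val) /=; have := ltn_ord v.
rewrite leq_eqVlt => /orP[/eqP eq_m|lt_m]; last by rewrite modn_small //; lia.
by rewrite {1}eq_m modnn; lia.
Qed.

(** Only the closing edge is listed against the cyclic orientation, whence a single sign. *)
Lemma cycle_denE (R : comNzRingType) (y : 'I_m -> R) :
  cycle_den y = - \prod_v (y v - y (ordS v)).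
Proof.
rewrite /cycle_den big_map big_enum /=.
rewrite (eq_bigr (fun v : 'I_m => (if (v.+1 < m)%N then 1 else -1) * (y v - y (ordS v)))).
  rewrite big_split /= -[RHS]mulN1r; congr (_ * _).
  case: (m) m_gt1 => [|k] // _; rewrite big_ord_recr /= ltnn big1 ?mul1r // => v _.
  by rewrite /= ltnS ltn_ord.
move=> v _; have -> : (v < ordS v)%N = (v.+1 < m)%N.
  rewrite /=; case: (ltnP v.+1 m) => [lt_m|le_m]; first by rewrite modn_small ?ltnSn.
  have -> : v.+1 = m by apply/eqP; rewrite eqn_leq le_m ltn_ord.
  by rewrite modnn leqn0 gtn_eqF // ltnW.
by case: ifP => _; rewrite ?mul1r ?mulN1r ?opprB.
Qed.

Lemma cycle_den_neq0 (R : idomainType) (y : 'I_m -> R) :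
  injective y -> cycle_den y != 0.
Proof.
move=> y_inj; rewrite cycle_denE oppr_eq0; apply/prodf_neq0 => v _.
by rewrite subr_eq0 inj_eq // eq_sym ordS_neq.
Qed.

(** Each p in [P] cancels its edge to p + 1 with a factor -1, and [cycle_denE] adds one more. This
    is the sign of the final identity. *)
Lemma cycle_num_den (K : fieldType) P c (y : 'I_m -> K) : injective y ->
  cycle_num P c y / cycle_den y = (-1) ^+ #|P|.+1 * (zmono P c y / cut_den P y).
Proof.
move=> y_inj; rewrite cycle_denE (bigID (mem P)) /= -/(cut_den P y) /cycle_num.
rewrite (eq_bigr (fun p => - (y p - y (ordS p)))) => [|p _]; last by rewrite opprB.
rewrite prodrN exprS.
set p1 := \prod_(p in P) _; have p1n0 : p1 != 0.
  by apply/prodf_neq0 => v _; rewrite subr_eq0 inj_eq // eq_sym ordS_neq.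
rewrite invrN invfM; move: (cut_den P y)^-1 => D.
by field.
Qed.

Lemma char0_identity (K : fieldType) d (x : 'I_m -> K) c :
  (forall k, k.+1%:R != 0 :> K) -> injective x -> (0 < d)%N -> (mdeg c + d = m)%N ->
  \sum_(P : {set 'I_m} | #|P| == d) \sum_(s : 'S_m)
    (weight P)%:R * cycle_num P c (fun v => x (s v)) / cycle_den (fun v => x (s v))
  = (-1) ^+ d.+1 * m`!%:R.
Proof.
move=> K_char0 x_inj d_gt0 deg_c.
rewrite -(sum_cut_sum K_char0 x_inj d_gt0 deg_c) mulr_sumr.
apply: eq_bigr => P /eqP cardP; rewrite /cut_sum mulrCA !mulr_sumr.
apply: eq_bigr => s _; rewrite -mulrA cycle_num_den ?cardP // => v w /x_inj.
exact: perm_inj.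
Qed.

End CycleSummand.

(** Clearing denominators leaves an identity in [A] itself, which ring morphisms preserve. *)
Lemma sum_frac_eq (A : idomainType) (I : finType) (a b : I -> A) (c : A) :
  (forall i, b i != 0) ->
  (\sum_i (a i)%:F / (b i)%:F = c%:F) <->
  (\sum_i a i * \prod_(j | j != i) b j = c * \prod_i b i).
Proof.
move=> b0; have B0 : \prod_i b i != 0 by apply/prodf_neq0.
have -> : \sum_i (a i)%:F / (b i)%:F =
    (\sum_i a i * \prod_(j | j != i) b j)%:F / (\prod_i b i)%:F.
  rewrite rmorph_sum mulr_suml; apply: eq_bigr => i _.
  rewrite (bigD1 i) //= in B0 *; rewrite mulf_eq0 negb_or in B0.
  case/andP: B0 => bi0 B0; rewrite !rmorphM /= -mulf_div divff ?mulr1 //.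
  by rewrite tofrac_eq0.
split=> [/(canRL (divfK _))|->]; last by rewrite tofracM mulfK ?tofrac_eq0.
by rewrite tofrac_eq0 -tofracM => /(_ B0)/eqP; rewrite tofrac_eq => /eqP.
Qed.

(** A morphism with a kernel, such as reduction modulo a prime, does not extend to fractions, hence
    the passage through cleared denominators. *)
Lemma sum_frac_rmorph (A B : idomainType) (f : {rmorphism A -> B}) (I : finType)
    (a b : I -> A) (c : A) :
  (forall i, f (b i) != 0) ->
  \sum_i (a i)%:F / (b i)%:F = c%:F ->
  \sum_i (f (a i))%:F / (f (b i))%:F = (f c)%:F.
Proof.
move=> fb0; have b0 i : b i != 0 by apply: contraNneq (fb0 i) => ->; rewrite rmorph0.
move/sum_frac_eq => /(_ b0)/(congr1 f) E; apply/sum_frac_eq => //.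
rewrite rmorphM rmorph_prod rmorph_sum in E; rewrite -E.
by apply: eq_bigr => i _; rewrite rmorphM rmorph_prod.
Qed.

Lemma mpolyXU_inj m (R : nzRingType) : injective (fun i : 'I_m => 'X_i : {mpoly R[m]}).
Proof.
move=> i j /(congr1 (mcoeff U_(i))) /eqP; rewrite !mcoeffX eqxx.
have [eq_U _|_] := eqVneq U_(j)%MM U_(i)%MM; last by rewrite oner_eq0.
move: (congr1 (fun c : 'X_{1..m} => c i) eq_U); rewrite !mnm1E eqxx.
by case: eqP.
Qed.

Lemma cycle_identity (F : fieldType) m d (c : 'X_{1..m}) :
  (1 < m)%N -> (0 < d)%N -> (mdeg c + d = m)%N ->
  \sum_(P : {set 'I_m} | #|P| == d) (weight P)%:R * \sum_(s : 'S_m)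
    (cycle_num P c (fun v => 'X_(s v) : {mpoly F[m]}))%:F /
    (cycle_den (fun v => 'X_(s v) : {mpoly F[m]}))%:F
  = (-1) ^+ d.+1 * m`!%:R.
Proof.
move=> m_gt1 d_gt0 deg_c.
(* The zero coefficient for subsets of other sizes lets the index range over a whole finite type. *)
pose a (R : idomainType) (i : {set 'I_m} * 'S_m) : {mpoly R[m]} :=
  (if #|i.1| == d then weight i.1 else 0)%:R * cycle_num i.1 c (fun v => 'X_(i.2 v)).
pose b (R : idomainType) (i : {set 'I_m} * 'S_m) : {mpoly R[m]} :=
  cycle_den (fun v => 'X_(i.2 v)).
have X_inj (R : idomainType) (s : 'S_m) : injective (fun v => 'X_(s v) : {mpoly R[m]}).
  by move=> v w /mpolyXU_inj /perm_inj.
have abE (R : idomainType) : \sum_i (a R i)%:F / (b R i)%:F =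
    \sum_(P : {set 'I_m} | #|P| == d) \sum_(s : 'S_m)
      (weight P)%:R * ((cycle_num P c (fun v => 'X_(s v) : {mpoly R[m]}))%:F /
        (cycle_den (fun v => 'X_(s v) : {mpoly R[m]}))%:F).
  rewrite -(pair_bigA _ (fun P s => (a R (P, s))%:F / (b R (P, s))%:F)) [RHS]big_mkcond /=.
  apply: eq_bigr => P _; case: ifP => cardP.
    by apply: eq_bigr => s _; rewrite /a /= cardP rmorphM /= rmorph_nat mulrA.
  by rewrite big1 // => s _; rewrite /a /= cardP mul0r rmorph0 mul0r.
have int_identity : \sum_i (a int i)%:F / (b int i)%:F = ((-1) ^+ d.+1 * m`!%:R)%:F.
  pose x v : {fraction {mpoly int[m]}} := ('X_v)%:F.
  rewrite abE rmorphM rmorphXn rmorphN1 rmorph_nat /=.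
  rewrite -(@char0_identity m m_gt1 _ d x c) //.
  - apply: eq_bigr => P _; apply: eq_bigr => s _.
    by rewrite -mulrA rmorph_cycle_num rmorph_cycle_den.
  - move=> k; have := tofrac_eq0 (k.+1%:R : {mpoly int[m]}); rewrite rmorph_nat => ->.
    by have := mpolyC_eq0 m (k.+1%:R : int); rewrite rmorph_nat Num.Theory.pnatr_eq0 => ->.
  - by move=> v w /eqP; rewrite /x tofrac_eq => /eqP /mpolyXU_inj.
under eq_bigr do rewrite mulr_sumr.
rewrite -abE.
(* Coefficients are mapped from the integers to [F]; only the values of [f] on the variables are
   retained. *)
have [f fX] : exists f : {rmorphism {mpoly int[m]} -> {mpoly F[m]}}, forall v, f 'X_v = 'X_v.
  by exists (map_mpoly (intr : int -> F)) => v; rewrite /= map_mpolyX.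
have fa i : f (a int i) = a F i.
  rewrite /a rmorphM (rmorph_nat f) (rmorph_cycle_num f); congr (_ * _).
  by apply: eq_cycle_num => v; apply: fX.
have fb i : f (b int i) = b F i.
  by rewrite rmorph_cycle_den; apply: eq_cycle_den => v; rewrite fX.
have fb0 i : f (b int i) != 0 by rewrite fb; apply: cycle_den_neq0 => //; apply: X_inj.
have := sum_frac_rmorph fb0 int_identity.
under eq_bigr do rewrite fa fb.
by move=> ->; rewrite !(rmorphM, rmorphXn, rmorphN1, rmorph_nat).
Qed.

(** * Evaluation and linearity of [DS] *)

Lemma DS_cycle (F : fieldType) m P (c : 'X_{1..m}) : (1 < m)%N ->
  DS (cycle_edges m) (cycle_num P c (fun v => 'X_v : {mpoly F[m]})) =
  \sum_(s : 'S_m) (cycle_num P c (fun v => 'X_(s v) : {mpoly F[m]}))%:F /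
    (cycle_den (fun v => 'X_(s v) : {mpoly F[m]}))%:F.
Proof.
move=> m_gt1; apply: eq_bigr => s _.
have sX v : msym s 'X_v = 'X_(s v) :> {mpoly F[m]} by rewrite /msym mmapX mmap1U.
have snum : msym s (cycle_num P c (fun v => 'X_v)) =
    cycle_num P c (fun v => 'X_(s v)) :> {mpoly F[m]}.
  by rewrite rmorph_cycle_num; apply: eq_cycle_num => v; apply: sX.
have sden : msym s (cycle_den (fun v => 'X_v)) =
    cycle_den (fun v => 'X_(s v)) :> {mpoly F[m]}.
  by rewrite rmorph_cycle_den; apply: eq_cycle_den => v; apply: sX.
rewrite -snum -sden; apply: fracsymE.
exact: (cycle_den_neq0 m_gt1 (@mpolyXU_inj m F)).
Qed.

(** [fracsym] is defined through representatives, so linearity is read off from [fracsymE] over the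
    common denominator. *)
Lemma DS_sum (F : fieldType) m (E : seq ('I_m * 'I_m)) (I : Type) (r : seq I)
    (a : I -> F) (g : I -> {mpoly F[m]}) :
  \prod_(e <- E) ('X_(e.1) - 'X_(e.2)) != 0 :> {mpoly F[m]} ->
  DS E (\sum_(i <- r) a i *: g i) = \sum_(i <- r) (a i)%:MP%:F * DS E (g i).
Proof.
move=> E0; rewrite [LHS](eq_bigr (fun s : 'S_m => \sum_(i <- r) (a i)%:MP%:F *
    fracsym s ((g i)%:F / (\prod_(e <- E) ('X_(e.1) - 'X_(e.2)))%:F))).
  by rewrite exchange_big; apply: eq_bigr => i _; rewrite mulr_sumr.
move=> s _; rewrite fracsymE //.
have -> : msym s (\sum_(i <- r) a i *: g i) = \sum_(i <- r) (a i)%:MP * msym s (g i).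
  rewrite (raddf_sum (msym s)); apply: eq_bigr => i _.
  by rewrite mul_mpolyC; apply: msymZ.
rewrite (rmorph_sum (@FracField.tofrac _)) mulr_suml; apply: eq_bigr => i _.
by rewrite fracsymE // mulrA; congr (_ / _); apply: tofracM.
Qed.

Theorem theorem6 (F : fieldType) (n d : nat) (n_gt0 : (0 < n)%N) (d_gt0 : (0 < d)%N)
    (h : {mpoly F[n + d]}) (hdeg : h \is n.-homog) :
  \sum_(P : {set 'I_(n + d)} | #|P| == d)
     (weight P)%:R *
     DS (cycle_edges (n + d))
        ((\prod_(p in P) ('X_(ordS p) - 'X_p))
         * (h \mPo [tuple zvar F P i | i < n + d]))
  = (-1) ^+ d.+1 * (((n + d)`!)%:R * h.@[fun=> 1])%:MP%:F.
Proof.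
set m := (n + d)%N; have m_gt1 : (1 < m)%N by rewrite /m; lia.
pose X v : {mpoly F[m]} := 'X_v.
have hE (P : {set 'I_m}) :
    (\prod_(p in P) ('X_(ordS p) - 'X_p)) * (h \mPo [tuple zvar F P i | i < m])
    = \sum_(c <- msupp h) h@_c *: cycle_num P c X.
  rewrite comp_mpolyEX mulr_sumr; apply: eq_bigr => c _.
  rewrite -scalerAr comp_mpolyX; congr (_ *: (_ * _)).
  by apply: eq_bigr => v _; rewrite tnth_mktuple.
under eq_bigr => P _.
  rewrite hE DS_sum ?mulr_sumr; last by exact: (cycle_den_neq0 m_gt1 (@mpolyXU_inj m F)).
  over.
(* Every monomial of [h] contributes the same constant, so the coefficients add up to h(1, ...,
   1). *)
rewrite exchange_big /= mevalE mulr_sumr !rmorph_sum /= mulr_sumr.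
apply: eq_big_seq => c c_supp; under eq_bigr do rewrite mulrCA DS_cycle //.
have deg_c : mdeg c = n by have /dhomogP/(_ c c_supp) := hdeg.
rewrite -mulr_sumr cycle_identity ?deg_c //.
rewrite big1 => [|v _]; last by rewrite expr1n.
rewrite mulr1 !(rmorphM, rmorph_nat) /=.
by rewrite mulrCA; congr (_ * _); apply: mulrC.
Qed.
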